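(* Let $X$ be a real Banach space whose modulus of smoothness satisfies $\rho(u)\le \gamma u^q$ for all $u>0$, where $1<q\le 2$ and $\gamma>0$ are constants, and let $\mathcal{D}$ be a dictionary in $X$. Then for every $f\in A_1^o(\mathcal{D})$ we have $$\sigma_m(f,\mathcal{D}) = o(m^{-1/p})\quad (m\to\infty),\qquad p:=\frac{q}{q-1}.$$
   Context: The modulus of smoothness of a Banach space $X$ is $\rho(u):=\sup_{\|x\|=\|y\|=1}\left(\frac{\|x+uy\|+\|x-uy\|}{2}-1\right)$. A dictionary in $X$ is a set $\mathcal{D}\subset X$ such that $\|g\|\le 1$ for every $g\in\mathcal{D}$, $g\in\mathcal{D}$ implies $-g\in\mathcal{D}$, and the closed linear span of $\mathcal{D}$ is $X$. $A_1^o(\mathcal{D}):=\{f\in X: f=\sum_{i=1}^\infty c_i g_i,\ g_i\in\mathcal{D},\ c_i\in\mathbb{R},\ \sum_{i=1}^\infty |c_i|\le 1\}$. The error of best $m$-term approximation is $\sigma_m(f,\mathcal{D}):=\inf_{c_1,\dots,c_m\in\mathbb{R};\ g_1,\dots,g_m\in\mathcal{D}}\left\|f-\sum_{i=1}^m c_i g_i\right\|_X$. *)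

(* Defs.v *)
From HB Require Import structures.
From mathcomp Require Import all_boot all_order all_algebra.
From mathcomp Require Import all_classical all_reals all_analysis.
Import Order.TTheory GRing.Theory Num.Theory.
Import numFieldNormedType.Exports.
Set Implicit Arguments.
Unset Strict Implicit.
Unset Printing Implicit Defensive.

Local Open Scope classical_set_scope.
Local Open Scope ring_scope.

(* The set below is always bounded above (by `|u|); it is empty only when X is
   the zero space, in which case the real [sup] is 0. *)
Definition modulus_of_smoothness (R : realType) (X : normedModType R) (u : R)
    : R :=
  sup [set r : R | exists x y : X, [/\ `|x| = 1, `|y| = 1 &
    r = (`|x + u *: y| + `|x - u *: y|) / 2 - 1]].

Definition linear_span (R : realType) (X : normedModType R) (D : set X)
    : set X :=
  [set f | exists (n : nat) (c : 'I_n -> R) (g : 'I_n -> X),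
    (forall i, D (g i)) /\ f = \sum_(i < n) c i *: g i].

Definition dictionary (R : realType) (X : normedModType R) (D : set X) : Prop :=
  [/\ forall g, D g -> `|g| <= 1,
      forall g, D g -> D (- g) &
      closure (linear_span D) = setT].

Definition A1o (R : realType) (X : normedModType R) (D : set X) : set X :=
  [set f | exists (c : nat -> R) (g : nat -> X),
    [/\ forall i, D (g i),
        series (fun i => c i *: g i) @ \oo --> f &
        (\sum_(0 <= i <oo) (`|c i|)%:E <= 1)%E]].

(* The atoms need not be distinct.  The infimum is over a set of nonnegative
   reals, which is nonempty as soon as D is. *)
Definition best_mterm_error (R : realType) (X : normedModType R) (D : set X)
    (f : X) (m : nat) : R :=
  inf [set r : R | exists (c : 'I_m -> R) (g : 'I_m -> X),
    (forall i, D (g i)) /\ r = `|f - \sum_(i < m) c i *: g i|].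

(* Main.v *)
Require Import Defs.
From HB Require Import structures.
From mathcomp Require Import all_boot all_order all_algebra ring lra zify.
From mathcomp Require Import all_classical all_reals all_analysis.
Import Order.TTheory GRing.Theory Num.Theory.
Import numFieldNormedType.Exports.
Local Open Scope classical_set_scope.
Local Open Scope ring_scope.

(** Two facts combine.

    First, averages of atoms converge at the rate [k `^ (q^-1 - 1)], which is
    [k `^ (- p^-1)].  Let [h = \sum_i c_i g_i] be a finite combination with
    [A = \sum_i |c_i|].  Up to signs, [h / A] is a convex combination of atoms
    [z_i], so the vectors [y_i = h / A - z_i] have weighted mean zero and norm
    at most 2.  Walk from the origin, adding one [y_i] at each step.  Smoothness
    bounds [|x + y_i| + |x - y_i|], and since the [y_i] have mean zero, some
    [|x - y_i|] is at least [|x|]; that same [y_i] increases [|x|] by only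
    [O(|x|^(1 - q))] ([exists_normD_le]).  Hence a step can be chosen to
    increase [|x|^q] by at most a constant ([exists_normD_powR_le]), and after
    [k] steps the norm is [O(k^(1/q))].  Dividing by [k] gives the error of the
    average of the [k] selected atoms, namely [A * O(k `^ (q^-1 - 1))]
    ([exists_average_le]).  This is Maurey's empirical method with the random
    choice replaced by a greedy one; averaging over [i] takes the place of a
    norming functional at [x].

    Second, the factor [A] turns this big-O into a little-o.  Split the series
    of [f] into its first [N] terms, a long finite block, and a remainder as
    small as desired.  The first part is reproduced exactly by [N] atoms.  The
    block has coefficient sum at most a tail of [\sum_i |c_i|], hence
    arbitrarily small for [N] large, and the other [m - N] atoms approximate it
    with error that tail times [O((m - N) `^ (- p^-1))]; for [m > 2 N] this is
    comparable with [m `^ (- p^-1)]. *)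

(** * Modulus of smoothness *)

Lemma modulus_of_smoothness_ge (R : realType) (X : normedModType R) (u : R)
    (x y : X) : `|x| = 1 -> `|y| = 1 ->
  (`|x + u *: y| + `|x - u *: y|) / 2 - 1 <= modulus_of_smoothness X u.
Proof.
move=> x1 y1; apply: ub_le_sup; last by exists x, y.
exists `|u| => _ [a [b [a1 b1 ->]]].
have := ler_normD a (u *: b); have := ler_normB a (u *: b).
rewrite normrZ a1 b1 mulr1 => h1 h2; move: `|_| `|_| `|_| h1 h2 => r s t; lra.
Qed.

(** * Greedy choice of averages *)

Lemma exists_ge_weighted_mean (R : realFieldType) (I : finType) (w a : I -> R)
    (v : R) : (forall i, 0 <= w i) -> \sum_i w i = 1 ->
  v <= \sum_i w i * a i -> exists i, v <= a i.
Proof.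
move=> w0 w1 hv.
have [//|no] := pselect (exists i, v <= a i).
have lt i : a i < v by rewrite ltNge; apply/negP => ?; apply: no; exists i.
have ge0 i : 0 <= w i * (v - a i) by rewrite mulr_ge0// subr_ge0 ltW.
have sum0 : \sum_i w i * (v - a i) = 0.
  apply/eqP; rewrite eq_le sumr_ge0 ?andbT//.
  under eq_bigr do rewrite mulrBr.
  by rewrite sumrB -mulr_suml w1 mul1r subr_le0.
have w_eq0 i : w i = 0.
  have /eqP := psumr_eq0P (fun i _ => ge0 i) sum0 (i := i) isT.
  by rewrite mulf_eq0 subr_eq0 (gt_eqF (lt i)) orbF => /eqP.
by move: w1; rewrite big1// => /eqP; rewrite eq_sym oner_eq0.
Qed.

Section PowerType.
Variables (R : realType) (X : normedModType R) (q gamma : R).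
Hypotheses (hq1 : 1 < q) (hq2 : q <= 2) (hgamma : 0 < gamma).
Hypothesis hrho : forall u : R, 0 < u ->
  modulus_of_smoothness X u <= gamma * u `^ q.

Let q_gt0 : 0 < q. Proof. exact: lt_trans hq1. Qed.

(** The homogeneous form of the smoothness hypothesis: it is applied to the
    normalized vectors with parameter [|y| / |x|]. *)
Lemma normD_normB_le (x y : X) : x != 0 ->
  `|x + y| + `|x - y| <= 2 * `|x| * (1 + gamma * (`|y| / `|x|) `^ q).
Proof.
move=> x0; have nx : 0 < `|x| by rewrite normr_gt0.
have [->|y0] := eqVneq y 0.
  rewrite addr0 subr0 normr0 mul0r powR0; last by rewrite gt_eqF.
  by lra.
have ny : 0 < `|y| by rewrite normr_gt0.
have unit_norm (z : X) : 0 < `|z| -> `| `|z|^-1 *: z| = 1.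
  move=> nz; rewrite normrZ ger0_norm ?invr_ge0 ?normr_ge0//.
  by rewrite mulVf// gt_eqF.
pose u := `|y| / `|x|; have u0 : 0 < u by rewrite divr_gt0.
have := le_trans (modulus_of_smoothness_ge _ _ u _ _
  (unit_norm _ nx) (unit_norm _ ny)) (hrho _ u0).
have uy : u *: (`|y|^-1 *: y) = `|x|^-1 *: y.
  by rewrite scalerA /u mulrAC mulfV ?mul1r// gt_eqF.
rewrite uy -scalerDr -scalerBr !normrZ ger0_norm ?invr_ge0 ?normr_ge0//.
rewrite -/u => h.
have -> : `|x + y| + `|x - y| =
    2 * `|x| * (1 + ((`|x|^-1 * `|x + y| + `|x|^-1 * `|x - y|) / 2 - 1)).
  by field; rewrite gt_eqF.
by apply: ler_wpM2l; [rewrite mulr_ge0// ltW|rewrite lerD2l].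
Qed.

(* The growth constant: [2 * gamma * |y| `^ q] for a step of norm 2. *)
Let B := 2 * gamma * 2 `^ q.

(** The norm of [x] is at most the weighted mean of the [|x - y i|], because the
    [y i] have mean zero; so some [|x - y i|] is at least [|x|], and the
    smoothness bound on [|x + y i| + |x - y i|] then controls [|x + y i|]. *)
Lemma exists_normD_le (I : finType) (w : I -> R) (y : I -> X) (x : X) :
    (forall i, 0 <= w i) -> \sum_i w i = 1 -> \sum_i w i *: y i = 0 ->
    (forall i, `|y i| <= 2) -> x != 0 ->
  exists i, `|x + y i| <= `|x| * (1 + B / `|x| `^ q).
Proof.
move=> w0 w1 wy y2 x0; have nx : 0 < `|x| by rewrite normr_gt0.
set V := `|x| * _.
have pair i : `|x + y i| + `|x - y i| <= V + `|x|.
  apply: (le_trans (normD_normB_le x (y i) x0)).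
  have : (`|y i| / `|x|) `^ q <= 2 `^ q / `|x| `^ q.
    rewrite -powRN -mulN1r powRrM powR_inv1// -powRM ?invr_ge0//.
    apply: ge0_ler_powR; rewrite ?nnegrE ?divr_ge0 ?(ltW q_gt0)//.
    by rewrite ler_pM2r ?invr_gt0.
  move=> /(ler_wpM2l (ltW hgamma)) h.
  have := ler_wpM2l (ltW nx) h.
  rewrite /V /B; lra.
have [|i xi] := exists_ge_weighted_mean _ _ w (fun i => `|x - y i|) `|x| w0 w1.
  have {1}-> : x = \sum_i w i *: (x - y i).
    under eq_bigr do rewrite scalerBr.
    by rewrite sumrB wy subr0 -scaler_suml w1 scale1r.
  apply: (le_trans (ler_norm_sum _ _ _)).
  by apply: ler_sum => i _; rewrite normrZ ger0_norm.
by exists i; have := pair i; lra.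
Qed.

(* [9] bounds [3 `^ q], for a step starting in the unit ball; the other terms
   come from expanding [(1 + B / |x| `^ q) ^+ 2] when [|x| >= 1]. *)
Let C := 9 + 2 * B + B ^+ 2.

Let B_ge0 : 0 <= B.
Proof. by rewrite /B !mulr_ge0 ?powR_ge0 ?(ltW hgamma). Qed.

(** Bounding [|x| `^ q] rather than [|x|] makes the increment independent of
    [x], so that the estimate can be iterated.  When [|x| < 1] the bound of
    [exists_normD_le] degenerates, but any step then stays in the ball of
    radius 3. *)
Lemma exists_normD_powR_le (I : finType) (w : I -> R) (y : I -> X) (x : X) :
    (forall i, 0 <= w i) -> \sum_i w i = 1 -> \sum_i w i *: y i = 0 ->
    (forall i, `|y i| <= 2) ->
  exists i, `|x + y i| `^ q <= `|x| `^ q + C.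
Proof.
move=> w0 w1 wy y2; have q_ge0 := ltW q_gt0.
have [x1|x1] := ltP `|x| 1.
  (* Weights of sum 1 provide an index, here an arbitrary one. *)
  have [|i _] := exists_ge_weighted_mean _ _ w (fun=> 0) 0 w0 w1.
    by rewrite big1// => i _; rewrite mulr0.
  exists i; apply: (@le_trans _ _ (3 `^ 2)); last first.
    rewrite powR_mulrn// /C; have := powR_ge0 `|x| q; have := B_ge0.
    have := sqr_ge0 B; lra.
  apply: (@le_trans _ _ (3 `^ q)); last by rewrite ler_powR// ler1n.
  apply: ge0_ler_powR; rewrite ?nnegrE//.
  by apply: le_trans (ler_normD _ _) _; have := y2 i; lra.
have x0 : x != 0 by rewrite -normr_gt0 (lt_le_trans ltr01).
have [i xi] := exists_normD_le _ w y x w0 w1 wy y2 x0; exists i.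
set a := `|x| `^ q in xi *.
have a1 : 1 <= a.
  have -> : 1 = 1 `^ q :> R by rewrite powR1.
  by apply: ge0_ler_powR; rewrite ?nnegrE.
have a0 : 0 < a by rewrite (lt_le_trans ltr01).
have Ba : 0 <= B / a by rewrite divr_ge0// ltW.
(* Here [q <= 2] is used: [(1 + t) `^ q <= (1 + t) ^+ 2]. *)
apply: (@le_trans _ _ (a * (1 + B / a) ^+ 2)).
  apply: (@le_trans _ _ ((`|x| * (1 + B / a)) `^ q)).
    by apply: ge0_ler_powR; rewrite ?nnegrE// mulr_ge0// addr_ge0.
  rewrite powRM ?addr_ge0// -/a ler_pM2l// -powR_mulrn ?addr_ge0//.
  by rewrite ler_powR// lerDl.
have -> : a * (1 + B / a) ^+ 2 = a + 2 * B + B ^+ 2 / a.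
  by field; rewrite gt_eqF.
have : B ^+ 2 / a <= B ^+ 2.
  by rewrite ler_pdivrMr// ler_peMr// sqr_ge0.
by rewrite /C; lra.
Qed.

Lemma exists_walk_norm_le (I : finType) (w : I -> R) (y : I -> X) :
    (forall i, 0 <= w i) -> \sum_i w i = 1 -> \sum_i w i *: y i = 0 ->
    (forall i, `|y i| <= 2) ->
  exists idx : nat -> I,
    forall k, `|\sum_(j < k) y (idx j)| `^ q <= C * k%:R.
Proof.
move=> w0 w1 wy y2.
have /choice[next nextP] := fun x => exists_normD_powR_le _ w y x w0 w1 wy y2.
pose S := fix S k := if k is k'.+1 then S k' + y (next (S k')) else 0.
exists (next \o S) => k.
have -> : \sum_(j < k) y ((next \o S) j) = S k.
  by elim: k => [|k IH]; rewrite ?big_ord0// big_ord_recr/= IH.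
elim: k => [|k IH]; first by rewrite normr0 powR0 ?mulr0// gt_eqF.
apply: le_trans (nextP (S k)) _.
by rewrite -natr1 mulrDr mulr1 lerD2r.
Qed.

(** After normalizing by the coefficient sum and absorbing signs into the atoms,
    the error of an average of atoms is the endpoint of a walk whose steps have
    mean zero, divided by its length. *)
Lemma exists_average_le (D : set X) (d0 : X) (n : nat) (c : 'I_n -> R)
    (g : 'I_n -> X) (k : nat) :
    (forall d, D d -> `|d| <= 1) -> (forall d, D d -> D (- d)) -> D d0 ->
    (forall i, D (g i)) -> (0 < k)%N ->
  exists (a : R) (d : nat -> X), (forall j, D (d j)) /\
    `|\sum_i c i *: g i - \sum_(j < k) a *: d j|
      <= (\sum_i `|c i|) * C `^ q^-1 * k%:R `^ (q^-1 - 1).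
Proof.
move=> D1 DN Dd0 Dg k0; set A := \sum_i `|c i|.
have kR : 0 < k%:R :> R by rewrite ltr0n.
have A0 : 0 <= A by exact: sumr_ge0.
have [Az|An] := eqVneq A 0.
  exists 0, (fun=> d0); split => //.
  rewrite big1 => [|i _]; last first.
    have /eqP := psumr_eq0P (fun i _ => normr_ge0 (c i)) Az (i := i) isT.
    by rewrite normr_eq0 => /eqP ->; rewrite scale0r.
  by rewrite big1 => [|i _]; rewrite ?scale0r// subrr normr0 Az !mul0r.
have Ap : 0 < A by rewrite lt_neqAle eq_sym An.
(* A test on [0 <= c i] rather than [Num.sg] keeps [z i] in [D] if [c i = 0]. *)
pose w i := `|c i| / A; pose z i := if 0 <= c i then g i else - g i.
have Dz i : D (z i) by rewrite /z; case: ifP => // _; exact: DN.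
have w0 i : 0 <= w i by rewrite divr_ge0.
have w1 : \sum_i w i = 1 by rewrite -mulr_suml mulfV.
pose h := \sum_i w i *: z i.
have Ah : \sum_i c i *: g i = A *: h.
  rewrite scaler_sumr; apply: eq_bigr => i _.
  rewrite scalerA /w mulrCA mulfV// mulr1 /z.
  by case: ger0P => // _; rewrite scalerN scaleNr opprK.
have h1 : `|h| <= 1.
  apply: (le_trans (ler_norm_sum _ _ _)); rewrite -w1.
  by apply: ler_sum => i _; rewrite normrZ ger0_norm// ler_piMr// D1.
have wy : \sum_i w i *: (h - z i) = 0.
  under eq_bigr do rewrite scalerBr.
  by rewrite sumrB -scaler_suml w1 scale1r subrr.
have y2 i : `|h - z i| <= 2.
  by apply: le_trans (ler_normB _ _) _; have := D1 _ (Dz i); lra.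
have [idx /(_ k) walk] := exists_walk_norm_le _ w _ w0 w1 wy y2.
exists (A / k%:R), (z \o idx); split => [j|]; first exact: Dz.
have -> : \sum_i c i *: g i - \sum_(j < k) (A / k%:R) *: (z \o idx) j =
    (A / k%:R) *: \sum_(j < k) (h - z (idx j)).
  rewrite Ah sumrB sumr_const card_ord scalerBr -scaler_sumr; congr (_ - _).
  by rewrite -(scaler_nat k h) scalerA divfK// gt_eqF.
rewrite normrZ ger0_norm ?divr_ge0// -!mulrA ler_pM2l//.
rewrite powRB; last by rewrite (gt_eqF kR) implybT.
rewrite powRr1 ?ler0n// mulrA [leLHS]mulrC ler_pM2r ?invr_gt0//.
have C0 : 0 <= C by have := B_ge0; have := sqr_ge0 B; rewrite /C; lra.
rewrite -powRM ?ler0n//.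
have -> : `|\sum_(j < k) (h - z (idx j))| =
    (`|\sum_(j < k) (h - z (idx j))| `^ q) `^ q^-1.
  by rewrite -powRrM mulfV ?powRr1// gt_eqF.
apply: ge0_ler_powR; rewrite ?nnegrE ?invr_ge0 ?powR_ge0 ?mulr_ge0 //.
exact: ltW.
Qed.

(** The previous estimate with its constant, which depends only on [q] and
    [gamma], abstracted. *)
Lemma average_rate : exists2 K : R, 0 <= K &
  forall (D : set X) (d0 : X) (n : nat) (c : 'I_n -> R) (g : 'I_n -> X)
    (k : nat),
    (forall d, D d -> `|d| <= 1) -> (forall d, D d -> D (- d)) -> D d0 ->
    (forall i, D (g i)) -> (0 < k)%N ->
  exists (a : R) (d : nat -> X), (forall j, D (d j)) /\
    `|\sum_i c i *: g i - \sum_(j < k) a *: d j|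
      <= (\sum_i `|c i|) * K * k%:R `^ (q^-1 - 1).
Proof. by exists (C `^ q^-1); [exact: powR_ge0|exact: exists_average_le]. Qed.

End PowerType.

(** * From the rate to the little-o *)

Lemma best_mterm_error_ge0 (R : realType) (X : normedModType R) (D : set X)
    (f : X) (m : nat) : 0 <= best_mterm_error D f m.
Proof.
rewrite /best_mterm_error; set E := (X in inf X).
have [->|/set0P[r Er]] := eqVneq E set0; first by rewrite inf0.
by apply: lb_le_inf; [exists r|move=> _ [? [? [_ ->]]]].
Qed.

(** Lets the budget of atoms be split between two independent combinations. *)
Lemma best_mterm_error_addn_le (R : realType) (X : normedModType R)
    (D : set X) (f : X) (N k : nat) (c a : nat -> R) (g d : nat -> X) :
    (forall i, D (g i)) -> (forall j, D (d j)) ->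
  best_mterm_error D f (N + k) <=
    `|f - (\sum_(i < N) c i *: g i + \sum_(j < k) a j *: d j)|.
Proof.
move=> Dg Dd; apply: ge_inf; first by exists 0 => _ [? [? [_ ->]]].
exists (fun i => match fintype.split i with inl i => c i | inr j => a j end).
exists (fun i => match fintype.split i with inl i => g i | inr j => d j end).
split=> [i|]; first by case: fintype.split.
congr (`|_ - _|); rewrite big_split_ord/=.
congr (_ + _); apply: eq_bigr => i _.
  by rewrite -[lshift _ _]/(fintype.unsplit (inl i)) unsplitK.
by rewrite -[rshift _ _]/(fintype.unsplit (inr i)) unsplitK.
Qed.

Lemma abs_sum_tail_small (R : realType) (c : nat -> R) (e : R) : 0 < e ->
    (\sum_(0 <= i <oo) (`|c i|)%:E < +oo)%E ->
  exists N, forall M, \sum_(N <= i < M) `|c i| <= e.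
Proof.
move=> e0 csum.
have c0 i : xpredT i -> (0 <= (`|c i|)%:E)%E by rewrite lee_fin.
have /fine_cvgP[] := nneseries_tail_cvg csum c0.
case=> N0 _ fin /cvgrPdist_le/(_ e e0)[N1 _ small].
pose N := maxn N0 N1; exists N => M.
rewrite -lee_fin -sumEFin.
have := @nneseries_lim_ge R (fun i => (`|c i|)%:E) xpredT N M (fun i _ => c0 i).
move=> /le_trans; apply.
have finN := fin N (leq_maxl _ _).
rewrite -(fineK finN) lee_fin.
have := small N (leq_maxr _ _); rewrite /= sub0r normrN.
exact/le_trans/ler_norm.
Qed.

Lemma powR_le_double (R : realType) (s : R) (k m : nat) :
    -1 <= s <= 0 -> (0 < k)%N -> (0 < m)%N -> (m <= k.*2)%N ->
  k%:R `^ s <= 2 * m%:R `^ s.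
Proof.
move=> /andP[s1 s0] k0 m0 mk.
pose t := - s; have -> : s = - t by rewrite opprK.
rewrite !(powRN _ t).
have kt : 0 < k%:R `^ t by rewrite powR_gt0 ?ltr0n.
have mt : 0 < m%:R `^ t by rewrite powR_gt0 ?ltr0n.
rewrite (ler_pdivlMr _ _ mt) mulrC (ler_pdivrMr _ _ kt).
apply: (@le_trans _ _ ((2 * k%:R) `^ t)).
  apply: ge0_ler_powR; rewrite ?nnegrE ?mulr_ge0 ?oppr_ge0//.
  by rewrite -natrM ler_nat mul2n.
rewrite powRM// ler_pM2r// -[leRHS](powRr1 (a := 2))//.
by rewrite ler_powR ?ler1n// /t lerNl.
Qed.

Theorem theorem1p1 (R : realType) (X : completeNormedModType R) (q gamma : R)
    (hq1 : 1 < q) (hq2 : q <= 2) (hgamma : 0 < gamma)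
    (hrho : forall u : R, 0 < u ->
      modulus_of_smoothness X u <= gamma * u `^ q)
    (D : set X) (hD : dictionary D) (f : X) (hf : A1o D f) :
  let p := q / (q - 1) in
  (fun m : nat => best_mterm_error D f m) =o_\oo
    (fun m : nat => m%:R `^ (- p^-1)).
Proof.
move=> p; have [D1 DN _] := hD; have [c [g [Dg cf csum]]] := hf.
have q0 : 0 < q := lt_trans ltr01 hq1.
have -> : - p^-1 = q^-1 - 1.
  by rewrite /p; field; rewrite (gt_eqF q0) subr_eq0 (gt_eqF hq1).
set s := q^-1 - 1.
have s01 : -1 <= s <= 0.
  have : 0 < q^-1 by rewrite invr_gt0.
  have : q^-1 <= 1 by rewrite invf_le1// ltW.
  by rewrite /s => ? ?; apply/andP; split; lra.
have [K K0 avg] := average_rate _ _ _ _ hq1 hq2 hgamma hrho.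
apply/eqoP => eps eps0; have K1 : 0 < K + 1 by lra.
(* The [4] pays for the factor 2 of [powR_le_double] and for leaving half of
   [eps] to the remainder of the series. *)
have e0 : 0 < eps / (4 * (K + 1)) by rewrite divr_gt0// mulr_gt0.
have [N tail] := abs_sum_tail_small _ _ _ e0 (le_lt_trans csum (ltry 1)).
near=> m.
have mN : (N.*2 < m)%N by near: m; exact: nbhs_infty_gt.
have m0 : (0 < m)%N := leq_ltn_trans (leq0n _) mN.
have [k mE] : exists k, m = (N + k)%N by exists (m - N)%N; lia.
have k0 : (0 < k)%N by lia.
have mk : (m <= k.*2)%N by lia.
have mR : 0 < m%:R `^ s :> R by rewrite powR_gt0 ?ltr0n.
have de0 : 0 < eps / 2 * m%:R `^ s by rewrite mulr_gt0// divr_gt0.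
have [M0 _ headP] := (cvgrPdist_le _ _).1 cf _ de0.
pose M := maxn M0 N.
have := headP M (leq_maxl _ _).
rewrite /series/= (big_cat_nat (n := N))//= ?leq_maxr// big_mkord.
rewrite -[X in index_iota X _](add0n N) big_addn big_mkord => rest.
have [a [d [Dd block]]] := avg D (g 0) _ (fun i : 'I_(M - N) => c (i + N)%N)
  (fun i => g (i + N)%N) k D1 DN (Dg 0) (fun i => Dg _) k0.
rewrite ger0_norm ?best_mterm_error_ge0// (gtr0_norm mR).
rewrite {1}mE.
apply: (le_trans (best_mterm_error_addn_le _ _ _ _ _ _ c (fun=> a) _ _ Dg Dd)).
set H := \sum_(i < N) _ in rest *; set T := \sum_(j < k) _.
set U := \sum_(i < M - N) _ in rest block.
(* [f - (H + U)] is the remainder of the series after [M] terms. *)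
have -> : f - (H + T) = (f - (H + U)) + (U - T).
  by rewrite !opprD !addrA subrK.
apply: (le_trans (ler_normD _ _)).
have tailM : \sum_(i < M - N) `|c (i + N)%N| <= eps / (4 * (K + 1)).
  by have := tail M; rewrite -[X in index_iota X _](add0n N) big_addn big_mkord.
have : `|U - T| <= eps / 2 * m%:R `^ s.
  apply: (le_trans block).
  apply: (@le_trans _ _ (eps / (4 * (K + 1)) * (K + 1) * (2 * m%:R `^ s))).
    apply: ler_pM; rewrite ?mulr_ge0 ?powR_ge0 ?sumr_ge0//.
      by apply: ler_pM; rewrite ?sumr_ge0// lerDl.
    exact: powR_le_double.
  rewrite le_eqVlt; apply/orP; left; apply/eqP.
  by field; rewrite gt_eqF.
by lra.
Unshelve. all: end_near. Qed.
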